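(* Let $G$ be a Lie group with Lie algebra $\mathfrak g$, let $A\colon\mathfrak g\to\mathfrak g^*$ be an inertia operator defining a right-invariant Riemannian metric on $G$, and let $F$ be a (differentiable) function on $\mathfrak g^*$. Then the double-bracket flow on $\mathfrak g^*$, $$\dot m=\operatorname{ad}^*_{A^{-1}\operatorname{ad}^*_{dF(m)}(m)}(m),$$ is the gradient flow of the restriction of $F$ to each coadjoint orbit $\mathcal O\subset\mathfrak g^*$; that is, on each $\mathcal O$ it is the flow $\dot m=-\operatorname{grad}_{\mathsf g}(F|_{\mathcal O})(m)$ for the Riemannian metric $\mathsf g$ on $\mathcal O$ induced by the right-invariant metric on $G$.
   Context: The group $G$ may be infinite-dimensional (Fréchet–Lie), in which case $\mathfrak g^*$ denotes the regular dual. $dF(m)$ is regarded as an element of $\mathfrak g$. The operator $\operatorname{ad}^*_v\colon\mathfrak g^*\to\mathfrak g^*$ is defined by $\langle\operatorname{ad}^*_v(m),\xi\rangle=\langle m,\operatorname{ad}_v\xi\rangle=\langle m,[v,\xi]\rangle$. $G$ acts on $\mathfrak g^*$ from the left by the coadjoint action, whose infinitesimal generator at $m$ in the direction $v$, denoted $v\cdot m$, equals $\operatorname{ad}^*_v(m)$ up to an overall sign depending on the sign convention for the bracket (the double-bracket equation does not depend on this sign). The inertia operator $A$ is a symmetric, positive definite, invertible linear map; it defines the right-invariant metric on $G$ with $\langle\langle u,v\rangle\rangle_e=\langle Au,v\rangle$ and $\langle\langle u\cdot g,v\cdot g\rangle\rangle_g=\langle\langle u,v\rangle\rangle_e$, where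 $u\cdot g\in T_gG$ is the right translate of $u\in\mathfrak g$ by $g$. Coadjoint orbits are assumed to be submanifolds, and the induced metric $\mathsf g$ on an orbit $\mathcal O$ is defined by: for $m\in\mathcal O$, $\mathsf g_m(v\cdot m,v\cdot m)=\langle\langle v,v\rangle\rangle_e$ whenever $v\in\mathfrak g$ is orthogonal, with respect to $\langle\langle\cdot,\cdot\rangle\rangle_e$, to the isotropy algebra $\{w\in\mathfrak g\mid w\cdot m=0\}$ (in infinite dimensions, $\mathfrak g$ is assumed to split as the direct sum of this isotropy algebra and its orthogonal complement). *)

(* Defs.v *)
From HB Require Import structures.
From mathcomp Require Import all_boot all_order all_algebra.
From mathcomp Require Import all_classical all_reals all_analysis.

Set Implicit Arguments.
Unset Strict Implicit.
Unset Printing Implicit Defensive.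

Import Order.TTheory GRing.Theory Num.Theory.
Import numFieldNormedType.Exports.

Local Open Scope classical_set_scope.
Local Open Scope ring_scope.

(* Differential calculus on locally convex spaces (Michal-Bastiani, also used  *)
(* by Hamilton and Milnor for Frechet manifolds).  The library's derive and    *)
(* differentiable are restricted to normed modules.                            *)
Section calculus.
Context {R : realType}.

Definition has_derive (E F : tvsType R) (f : E -> F) (x v : E) (w : F) : Prop :=
  h^-1 *: (f (x + h *: v) - f x) @[h --> (0 : R)^'] --> w.

(* Default value 0 when the directional derivative does not exist. *)
Definition dderive (E F : tvsType R) (f : E -> F) (x v : E) : F :=
  xget 0 [set w | has_derive f x v w].

(* Meant for open U.  Df is viewed as the function (x, v) |-> Df(x)v on        *)
(* U x E, whose joint continuity (and not continuity for some topology on the  *)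
(* space of linear maps) is required.                                          *)
Fixpoint class_C (n : nat) (E F : tvsType R) (U : set E) (f : E -> F) : Prop :=
  {in U, continuous f} /\
  match n with
  | 0 => True
  | n'.+1 =>
      (forall x v, U x -> exists w, has_derive f x v w) /\
      class_C n' (U `*` [set: E] : set (E * E)%type)
                 (fun xv : E * E => dderive f xv.1 xv.2)
  end.

Definition smooth_on (E F : tvsType R) (U : set E) (f : E -> F) : Prop :=
  forall n, class_C n U f.

(* Completeness is stated with the Cauchy filters of the vector topology: the  *)
(* uniform structure carried by a tvsType is not required to be                *)
(* translation-invariant.                                                      *)
Definition frechet_space (E : tvsType R) : Prop :=
  [/\ hausdorff_space E,
      exists B : nat -> set E, (forall n, nbhs 0 (B n)) /\
        (forall U, nbhs 0 U -> exists n, B n `<=` U)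
    & forall F : set_system E, ProperFilter F ->
        (forall U, nbhs 0 U ->
           exists2 S, F S & forall x y, S x -> S y -> U (x - y)) ->
        exists x : E, F --> x].

Definition finite_dimensional (E : lmodType R) : Prop :=
  exists s : seq E, forall v : E,
    exists c : nat -> R, v = \sum_(i < size s) c i *: s`_i.

End calculus.

(* Manifolds modelled on a locally convex space E.  An atlas is given as a     *)
(* family of charts indexed by points, the chart of index p containing p.      *)
Section manifolds.
Context {R : realType}.

(* chart_inv is only meaningful on the image of chart_dom. *)
Record chart (M : Type) (E : tvsType R) := Chart {
  chart_dom : set M;
  chart_map : M -> E;
  chart_inv : E -> M
}.

Definition is_chart (M : topologicalType) (E : tvsType R) (c : chart M E) :=
  [/\ open (chart_dom c),
      open (chart_map c @` chart_dom c),
      (forall p, chart_dom c p -> chart_inv c (chart_map c p) = p),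
      {in chart_dom c, continuous (chart_map c)}
    & {in chart_map c @` chart_dom c, continuous (chart_inv c)}].

Definition atlas (M : Type) (E : tvsType R) := M -> chart M E.

Definition is_manifold (M : topologicalType) (E : tvsType R) (ch : atlas M E) :=
  [/\ hausdorff_space M,
      (forall p, chart_dom (ch p) p),
      (forall p, is_chart (ch p))
    & forall p q,
        smooth_on (chart_map (ch p) @` (chart_dom (ch p) `&` chart_dom (ch q)))
                  (chart_map (ch q) \o chart_inv (ch p))].

Definition smooth (M N : topologicalType) (E F : tvsType R)
    (chM : atlas M E) (chN : atlas N F) (f : M -> N) : Prop :=
  continuous f /\
  forall p q,
    smooth_on (chart_map (chM p) @`
                 (chart_dom (chM p) `&` f @^-1` chart_dom (chN q)))
              (chart_map (chN q) \o f \o chart_inv (chM p)).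

Definition vector_atlas (E : tvsType R) : atlas E E :=
  fun=> Chart setT id id.

Definition prod_atlas (M N : Type) (E F : tvsType R)
    (chM : atlas M E) (chN : atlas N F) : atlas (M * N)%type (E * F)%type :=
  fun p => Chart (chart_dom (chM p.1) `*` chart_dom (chN p.2))
    (fun x => (chart_map (chM p.1) x.1, chart_map (chN p.2) x.2))
    (fun y => (chart_inv (chM p.1) y.1, chart_inv (chN p.2) y.2)).

(* The tangent space at p is identified with the model space by the chart of   *)
(* index p.                                                                    *)
Definition tangent (M : Type) (E : tvsType R) (ch : atlas M E) (p : M)
  : tvsType R := E.

Definition tmap (M N : Type) (E F : tvsType R)
    (chM : atlas M E) (chN : atlas N F) (f : M -> N) (p : M)
    (v : tangent chM p) : tangent chN (f p) :=
  dderive (chart_map (chN (f p)) \o f \o chart_inv (chM p))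
          (chart_map (chM p) p) v.

Definition has_velocity (M : topologicalType) (E : tvsType R) (ch : atlas M E)
    (c : R -> M) (t : R) (v : tangent ch (c t)) : Prop :=
  {for t, continuous c} /\
  has_derive (chart_map (ch (c t)) \o c : R^o -> E) t 1 v.

End manifolds.
Arguments vector_atlas {R} E.
Arguments tmap {R M N E F} chM chN f p v.
Arguments tangent {R M E} ch p.
Arguments is_manifold {R M E} ch.
Arguments smooth {R M N E F} chM chN f.
Arguments has_velocity {R M E} ch c t v.

#[short(type="preTopologicalGroupType")]
HB.structure Definition PreTopologicalGroup := {G of Group G & Topological G}.

Section lie_groups.
Context {R : realType} (E : tvsType R) (G : preTopologicalGroupType).
Variable ch : atlas G E.

Definition is_lie_group : Prop :=
  [/\ frechet_space E,
      is_manifold ch,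
      smooth (prod_atlas ch ch) ch (fun ab : G * G => (ab.1 * ab.2)%g)
    & smooth ch ch (fun a : G => (a^-1)%g)].

Definition lie_algebra : tvsType R := tangent ch (1%g : G).

Local Notation g := lie_algebra.

(* The derivative lands in the tangent space at a * 1 * a^-1 = 1. *)
Definition Ad (a : G) (xi : g) : g :=
  tmap ch ch (fun x => (a * x * a^-1)%g) 1%g xi.

Definition ad (u v : g) : g :=
  tmap ch (vector_atlas g) (fun a => Ad a v) 1%g u.

(* Both sign conventions (left- or right-invariant vector fields) are allowed. *)
Definition is_lie_bracket (br : g -> g -> g) : Prop :=
  br = ad \/ br = (fun u v => - ad u v).

Definition right_translate (u : g) (a : G) : tangent ch a :=
  tmap ch ch (fun x => (x * a)%g) 1%g u.

Section dual.
Context (gs : tvsType R) (pair : gs -> g -> R).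

(* In finite dimension this forces gs to be the full dual of g. *)
Definition is_regular_dual : Prop :=
  [/\ (forall xi, linear (pair ^~ xi : gs -> R^o)) /\
        (forall m, linear (pair m : g -> R^o)),
      (forall xi, continuous (pair ^~ xi)) /\ (forall m, continuous (pair m)),
      (forall m, (forall xi, pair m xi = 0) -> m = 0)
    & (forall xi, (forall m, pair m xi = 0) -> xi = 0)].

(* Only the orbit maps are required to be smooth: joint smoothness of the      *)
(* action fails for some topologies on duals of Frechet spaces.                *)
Definition is_coadjoint_action (Ads : G -> gs -> gs) : Prop :=
  (forall a m xi, pair (Ads a m) xi = pair m (Ad (a^-1)%g xi)) /\
  (forall m, smooth ch (vector_atlas gs) (Ads ^~ m)).

Definition is_ad_star (br : g -> g -> g) (ads : g -> gs -> gs) : Prop :=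
  forall v m xi, pair (ads v m) xi = pair m (br v xi).

(* v . m *)
Definition generator (Ads : G -> gs -> gs) (v : g) (m : gs) : gs :=
  tmap ch (vector_atlas gs) (Ads ^~ m) 1%g v.

Definition isotropy_algebra (Ads : G -> gs -> gs) (m : gs) : set g :=
  [set w | generator Ads w m = 0].

Definition coadjoint_orbit (Ads : G -> gs -> gs) (m : gs) : set gs :=
  range (Ads ^~ m).

Definition is_inertia_operator (A : g -> gs) : Prop :=
  [/\ linear A,
      (forall u v, pair (A u) v = pair (A v) u),
      (forall u, u != 0 -> 0 < pair (A u) u)
    & bijective A].

Definition is_right_invariant_metric (A : g -> gs)
    (rho : forall a : G, tangent ch a -> tangent ch a -> R) : Prop :=
  (forall u v : g, rho 1%g u v = pair (A u) v) /\
  (forall a (u v : g),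
     rho a (right_translate u a) (right_translate v a) = rho 1%g u v).

(* dF(m) = xi, as Hadamard differentiability: it is Frechet differentiability  *)
(* in finite dimension, and is implied by C^1 in any locally convex space.     *)
Definition has_differential (F : gs -> R) (m : gs) (xi : g) : Prop :=
  forall k : gs,
    tk.1^-1 * (F (m + tk.1 *: tk.2) - F m)
      @[tk --> filter_prod (0 : R)^' (nbhs k)] --> pair k xi.

Definition double_bracket (ads : g -> gs -> gs) (Ainv : gs -> g)
    (dF : gs -> g) (m : gs) : gs :=
  ads (Ainv (ads (dF m) m)) m.

End dual.

Definition orthogonal_to (rho1 : g -> g -> R) (W : set g) : set g :=
  [set v | forall w, W w -> rho1 v w = 0].

Definition splits (rho1 : g -> g -> R) (W : set g) : Prop :=
  forall v, exists w u, [/\ W w, orthogonal_to rho1 W u & v = w + u].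

Section orbits.
Context (gs : tvsType R) (Ads : G -> gs -> gs).
Context (N : topologicalType) (H : tvsType R) (chN : atlas N H).
Variable iota : N -> gs.

Local Notation Tiota := (tmap chN (vector_atlas gs) iota).

(* The orbit O of m0 as an (injectively immersed) submanifold iota : N -> g^*, *)
(* with T_m O = {v . m | v in g}.                                              *)
Definition is_orbit_submanifold (m0 : gs) : Prop :=
  [/\ is_manifold chN,
      injective iota /\ range iota = coadjoint_orbit Ads m0,
      smooth chN (vector_atlas gs) iota,
      (forall p, injective (Tiota p))
    & (forall p, range (Tiota p) = range (generator Ads ^~ (iota p)))].

Definition is_induced_metric (rho1 : g -> g -> R)
    (gO : forall p : N, tangent chN p -> tangent chN p -> R) : Prop :=
  [/\ (forall p (Y : tangent chN p), linear (gO p Y : tangent chN p -> R^o)),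
      (forall p (X Y : tangent chN p), gO p X Y = gO p Y X)
    & (forall p (X : tangent chN p) (v : g),
         orthogonal_to rho1 (isotropy_algebra Ads (iota p)) v ->
         Tiota p X = generator Ads v (iota p) ->
         gO p X X = rho1 v v)].

End orbits.

End lie_groups.
Arguments is_lie_group {R E G} ch.
Arguments lie_algebra {R E G} ch.
Arguments is_lie_bracket {R E G ch} br.
Arguments is_regular_dual {R E G ch gs} pair.
Arguments is_coadjoint_action {R E G ch gs} pair Ads.
Arguments is_ad_star {R E G ch gs} pair br ads.
Arguments isotropy_algebra {R E G} ch {gs} Ads m.
Arguments coadjoint_orbit {R G gs} Ads m.
Arguments is_inertia_operator {R E G ch gs} pair A.
Arguments is_right_invariant_metric {R E G ch gs} pair A rho.
Arguments has_differential {R E G ch gs} pair F m xi.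
Arguments double_bracket {R E G ch gs} ads Ainv dF m.
Arguments splits {R E G ch} rho1 W.
Arguments is_orbit_submanifold {R E G} ch {gs} Ads {N H} chN iota m0.
Arguments is_induced_metric {R E G ch gs} Ads {N H chN} iota rho1 gO.

Section gradient.
Context {R : realType} (N : topologicalType) (H : tvsType R) (chN : atlas N H).
Variable gO : forall p : N, tangent chN p -> tangent chN p -> R.

Definition is_gradient (f : N -> R) (X : forall p, tangent chN p) : Prop :=
  forall p (Y : tangent chN p),
    gO (X p) Y = tmap chN (vector_atlas R^o) f p Y.

End gradient.
Arguments is_gradient {R N H chN} gO f X.

(* Main.v *)
(* For xi in g the generator of the coadjoint action pairs with xi as          *)
(* <v.m, xi> = - <m, [v, xi]>, so ad*_v(m) = v.m up to a sign that occurs      *)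
(* twice in the double bracket; the flow is thus dm/dt = V.m with              *)
(* V = A^-1(dF(m).m).  By antisymmetry of the bracket,                         *)
(* <<V, w>> = <dF(m).m, w> = - <w.m, dF(m)>, hence V is orthogonal to the      *)
(* isotropy algebra of m, and g(V.m, w.m) = <<V, w>> = - <w.m, dF(m)> for      *)
(* every w orthogonal to it: V.m is minus the gradient.                        *)
(* The analytic input is the calculus of C^1 and C^2 maps between locally      *)
(* convex spaces: a mean value inequality for convex open sets gives strict    *)
(* differentiability, whence the chain rule and the symmetry of second         *)
(* derivatives.  In the chart at 1 the latter yields                           *)
(* [v, w] = B(v, w) - B(w, v), with B the mixed second derivative of the       *)
(* product, and so the antisymmetry of the bracket.                            *)

Require Import Defs.
From mathcomp Require Import all_boot all_order all_algebra.
From mathcomp Require Import all_classical all_reals all_analysis.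
From mathcomp Require Import ring lra.
Import Order.TTheory GRing.Theory Num.Theory.
Import numFieldNormedType.Exports.
Local Open Scope classical_set_scope.
Local Open Scope ring_scope.

Set Implicit Arguments.
Unset Strict Implicit.
Unset Printing Implicit Defensive.

(** * Calculus in locally convex spaces *)

(** With [V = Ainv (dF(m).m)], [pair_generator] and [adC] give [<<V, w>> = - <w.m, dF(m)>]. This
    vanishes when [w.m = 0], so [V] is exactly the representative by which the induced metric
    measures the tangent vector [V.m]. By polarization, the metric of [V.m] against [w.m], for [w]
    orthogonal to the isotropy algebra, is [<<V, w>>], and [tmap_differential] recognizes minus the
    derivative of [F] along [w.m]. Such a [w] exists for every tangent vector, by assumption or by
    [finite_dimensional_projection]. Finally [double_bracket_generator] identifies [V.m] with the
    double bracket. The Lie-theoretic facts rest on two results of calculus: [class_C1_strict],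
    which yields the chain rule, and [dderive_symmetric], applied to the product in the chart at the
    identity. *)

Section tvs_limits.
Context {R : realType}.
Implicit Types E F : tvsType R.

Lemma tvs_cvgD E T (FF : set_system T) {HF : Filter FF} (f g : T -> E) (a b : E) :
  f @ FF --> a -> g @ FF --> b -> (fun x => f x + g x) @ FF --> a + b.
Proof.
by move=> fa gb; apply: continuous2_cvg => //; exact: (@tvs.add_continuous E (a, b)).
Qed.

Lemma tvs_cvgZ E T (FF : set_system T) {HF : Filter FF} (k : T -> R^o)
    (f : T -> E) (c : R^o) (a : E) :
  k @ FF --> c -> f @ FF --> a -> (fun x => k x *: f x) @ FF --> c *: a.
Proof.
by move=> kc fa; apply: continuous2_cvg => //; exact: (@tvs.scale_continuous R E (c, a)).
Qed.

Lemma tvs_cvgZr E T (FF : set_system T) {HF : Filter FF} (k : R) (f : T -> E) (a : E) :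
  f @ FF --> a -> (fun x => k *: f x) @ FF --> k *: a.
Proof. by apply: (@tvs_cvgZ E T FF HF (fun=> k : R^o)); exact: cvg_cst. Qed.

Lemma tvs_cvgN E T (FF : set_system T) {HF : Filter FF} (f : T -> E) (a : E) :
  f @ FF --> a -> (fun x => - f x) @ FF --> - a.
Proof.
move=> fa; rewrite -scaleN1r.
rewrite (_ : (fun x => - f x) = (fun x => -1 *: f x)); last first.
  by apply/funext => x; rewrite scaleN1r.
exact: tvs_cvgZr.
Qed.

Lemma tvs_cvgB E T (FF : set_system T) {HF : Filter FF} (f g : T -> E) (a b : E) :
  f @ FF --> a -> g @ FF --> b -> (fun x => f x - g x) @ FF --> a - b.
Proof. by move=> fa gb; apply: tvs_cvgD => //; exact: tvs_cvgN. Qed.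

Lemma convex_open_nbhs E (x : E) (W : set E) : nbhs x W ->
  exists C : set E, [/\ open C, C x, C `<=` W &
    forall y z (t : R), C y -> C z -> 0 <= t -> t <= 1 ->
      C (t *: y + (1 - t) *: z)].
Proof.
move=> Wx; have [B Bc [Bo /(_ x W Wx)[C /= [BC Cx CW]]]] := @locally_convex R E.
exists C; split=> //; first exact: Bo.
move=> y z t Cy Cz t0 t1.
have t01 : Itv.spec (@Itv.num_sem R) (Itv.Real `[0%Z, 1%Z]) t.
  by rewrite /Itv.spec/= /Itv.num_sem num_real/= in_itv/= t0 t1.
have := Bc C (mem_set BC) y z (Itv.mk t01) (mem_set Cy) (mem_set Cz).
by rewrite inE.
Qed.

End tvs_limits.
Arguments tvs_cvgZr {R E T FF HF} k {f a}.

(** * Mean value inequality for convex sets *)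

Section mean_value.
Context {R : realType} (E : tvsType R).

(* The local hypothesis on difference quotients propagates along [0, 1] by     *)
(* convexity: if the quotients over [0, s] and [s, t] lie in C, so does the    *)
(* one over [0, t].                                                            *)
Lemma convex_mean_value (C : set E) (phi : R -> E) :
  (forall y z (t : R), C y -> C z -> 0 <= t -> t <= 1 ->
      C (t *: y + (1 - t) *: z)) ->
  (forall s : R, 0 <= s <= 1 -> \forall h \near (0 : R)^',
      C (h^-1 *: (phi (s + h) - phi s))) ->
  C (phi 1 - phi 0).
Proof.
move=> Cconv loc.
pose S := [set s : R | 0 <= s <= 1 /\ (s = 0 \/ C (s^-1 *: (phi s - phi 0)))].
have S0 : S 0 by split; [rewrite lexx ler01|left].
have Sub : ubound S 1 by move=> s [/andP[]].
have Ssup : has_sup S by split; [exists 0|exists 1].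
set sg := sup S.
have sg0 : 0 <= sg by apply: ub_le_sup => //; exists 1.
have sg1 : sg <= 1 by apply: ge_sup => //; exists 0.
have step s t : S s -> s < t -> t <= 1 -> C ((t - s)^-1 *: (phi t - phi s)) -> S t.
  move=> [/andP[s0 s1] Ss] st t1 Cst.
  have t0 : 0 < t by apply: le_lt_trans st.
  split; first by rewrite ltW.
  right; case: Ss => [s00|Ss]; first by rewrite s00 subr0 in Cst.
  have [s00|sn0] := eqVneq s 0; first by rewrite s00 subr0 in Cst.
  have -> : t^-1 *: (phi t - phi 0) = (s / t) *: (s^-1 *: (phi s - phi 0)) +
     (1 - s / t) *: ((t - s)^-1 *: (phi t - phi s)).
    have ts : t - s != 0 by rewrite subr_eq0 gt_eqF.
    have tn0 : t != 0 by rewrite gt_eqF.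
    rewrite !scalerA mulrAC divff// mul1r.
    have -> : (1 - s / t) / (t - s) = t^-1 by field; rewrite ts tn0.
    by rewrite -scalerDr [in RHS]addrC addrA subrK.
  apply: Cconv => //; first by rewrite divr_ge0// ltW.
  by rewrite ler_pdivrMr// mul1r ltW.
have [d d0 Hd] : exists2 d, 0 < d &
    forall h, 0 < `|h| < d -> C (h^-1 *: (phi (sg + h) - phi sg)).
  have /loc : 0 <= sg <= 1 by rewrite sg0.
  rewrite near_withinE => /nbhs_ballP[d /= d0 Hd]; exists d => // h /andP[h0 hd].
  apply: Hd; last by rewrite -normr_gt0.
  by rewrite -ball_normE/= sub0r normrN.
(* Some [s] in [S] lies within [d] of [sg]; the quotient over [[s, sg]] is the local one at [sg]
   with the negative increment [s - sg]. *)
have Ssg : S sg.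
  have [s Ss] := sup_adherent d0 Ssup; rewrite -/sg => sgs.
  have : s <= sg by apply: ub_le_sup => //; exists 1.
  rewrite le_eqVlt => /orP[/eqP <- //|ssg].
  apply: (step s sg) => //.
  have := Hd (s - sg); rewrite (addrC sg) subrK.
  rewrite -(opprB (phi sg)) -(opprB sg s) invrN scalerN scaleNr opprK normrN; apply.
  by rewrite gtr0_norm ?subr_gt0// ssg/= ltrBlDr -ltrBlDl.
move: sg1; rewrite le_eqVlt => /orP[/eqP sg1|sg1].
  case: Ssg => _; rewrite sg1 => -[/eqP|]; first by rewrite oner_eq0.
  by rewrite invr1 scale1r.
(* If [sg < 1], the local hypothesis at [sg] puts a larger point in [S]. *)
pose t := Num.min 1 (sg + d / 2).
have sgt : sg < t by rewrite lt_min sg1/= ltrDl divr_gt0.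
have : S t.
  apply: (step sg t) => //; first by rewrite ge_min lexx.
  have := Hd (t - sg); rewrite (addrC sg) subrK; apply.
  rewrite gtr0_norm ?subr_gt0// sgt/= ltrBlDl gt_min.
  by rewrite ltrD2l ltr_pdivrMr// ltr_pMr// ltr1n orbT.
move=> St; have : t <= sg by apply: ub_le_sup => //; exists 1.
by rewrite leNgt sgt.
Qed.

End mean_value.

(** * Strict differentiability, chain rule, symmetry of second derivatives *)

Section curve_derive.
Context {R : realType}.
Implicit Types E F G : tvsType R.

(* Velocity at 0 of a curve through x; has_derive f x v is by definition the   *)
(* instance c := fun h => f (x + h *: v).                                      *)
Definition curve_derive E (c : R -> E) (x w : E) : Prop :=
  h^-1 *: (c h - x) @[h --> (0 : R)^'] --> w.

Lemma has_dderive E F (f : E -> F) (x v : E) :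
  (exists w, has_derive f x v w) -> has_derive f x v (dderive f x v).
Proof. by move=> ex; apply: (xgetPex 0 ex). Qed.

Lemma curve_derive_unique E (c : R -> E) (x w1 w2 : E) : hausdorff_space E ->
  curve_derive c x w1 -> curve_derive c x w2 -> w1 = w2.
Proof. by move=> hE; apply: cvg_unique. Qed.

Lemma dderiveE E F (f : E -> F) (x v : E) (w : F) : hausdorff_space F ->
  has_derive f x v w -> dderive f x v = w.
Proof.
by move=> hF fw; apply: (curve_derive_unique hF _ fw); apply: has_dderive; exists w.
Qed.

Lemma curve_derive_near E (c c' : R -> E) (x w : E) :
  (\forall h \near (0 : R)^', c h = c' h) ->
  curve_derive c x w -> curve_derive c' x w.
Proof.
move=> cc'; rewrite /curve_derive; apply: cvg_trans; apply: near_eq_cvg.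
by apply: filterS cc' => h ->.
Qed.

Lemma curve_derive_cvg E (c : R -> E) (x w : E) :
  curve_derive c x w -> c h @[h --> (0 : R)^'] --> x.
Proof.
move=> cw; rewrite -[X in _ --> X](addr0 x) -(scale0r w).
have : (fun h : R => x + (h : R^o) *: (h^-1 *: (c h - x))) @ (0 : R)^' -->
    x + (0 : R^o) *: w.
  apply: tvs_cvgD; first exact: cvg_cst.
  by apply: tvs_cvgZ => //; exact: cvg_within.
apply: cvg_trans; apply: near_eq_cvg; near=> h.
have h0 : h != 0 by near: h; exact: nbhs_dnbhs_neq.
by rewrite scalerA divff// scale1r addrC subrK.
Unshelve. all: by end_near. Qed.

Lemma curve_derive_pair E F (c : R -> E) (d : R -> F) x y w z :
  curve_derive c x w -> curve_derive d y z ->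
  curve_derive (fun h => (c h, d h)) (x, y) (w, z).
Proof. exact: cvg_pair. Qed.

Lemma curve_derive_cst E (x : E) : curve_derive (fun=> x) x 0.
Proof.
rewrite /curve_derive (_ : (fun h : R => _) = fun=> 0); first exact: cvg_cst.
by apply/funext => h; rewrite subrr scaler0.
Qed.

Arguments curve_derive_cst {E} x.

Lemma curve_derive_line E (x v : E) : curve_derive (fun h => x + h *: v) x v.
Proof.
apply: cvg_near_cst; near=> h.
have h0 : h != 0 by near: h; exact: nbhs_dnbhs_neq.
by rewrite addrC addKr scalerA mulVf// scale1r.
Unshelve. all: by end_near. Qed.

Arguments curve_derive_line {E} x v.

Lemma has_deriveZ E F (f : E -> F) (x v : E) (w : F) (a : R) :
  has_derive f x v w -> has_derive f x (a *: v) (a *: w).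
Proof.
have [->|a0] := eqVneq a 0.
  move=> _; rewrite !scale0r /has_derive.
  rewrite (_ : (fun h : R => _) = fun=> 0); first exact: cvg_cst.
  by apply/funext => h; rewrite scaler0 addr0 subrr scaler0.
rewrite /has_derive => fw.
have ha : (fun h : R => h * a) @ (0 : R)^' --> (0 : R)^'.
  have ha0 : (fun h : R => h * a) @ (0 : R)^' --> (0 : R).
    rewrite -[X in _ --> X](mul0r a); apply: cvgM; last exact: cvg_cst.
    exact: cvg_within.
  move=> W W0; rewrite nbhs_simpl /=; near=> h.
  have : h * a != 0 by rewrite mulf_neq0//; near: h; exact: nbhs_dnbhs_neq.
  by near: h; exact: ha0 W0.
have := cvg_comp _ _ ha fw => /(tvs_cvgZr a).
apply: cvg_trans; apply: near_eq_cvg; near=> h.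
have h0 : h != 0 by near: h; exact: nbhs_dnbhs_neq.
by rewrite /= !scalerA invfM mulrCA divff// mulr1.
Unshelve. all: by end_near. Qed.

Arguments has_deriveZ {E F f x v w} a.

Lemma dderiveZ E F (f : E -> F) (x v : E) (a : R) : hausdorff_space F ->
  (exists w, has_derive f x v w) -> dderive f x (a *: v) = a *: dderive f x v.
Proof. by move=> hF ex; apply: dderiveE => //; apply/has_deriveZ/has_dderive. Qed.

Lemma open_setX E F (A : set E) (B : set F) : open A -> open B -> open (A `*` B).
Proof.
move=> oA oB; rewrite openE => -[x y] [/= Ax By]; exists (A, B) => //.
by split; exact: open_nbhs_nbhs.
Qed.

(* Mean value inequality on the segment from y to y + tu. *)
Lemma class_C1_strict E F (U : set E) (f : E -> F) (x v : E) :
  open U -> class_C 1 U f -> U x ->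
  p.2^-1 *: (f (p.1.1 + p.2 *: p.1.2) - f p.1.1)
    @[p --> filter_prod (filter_prod (nbhs x) (nbhs v)) (0 : R)^']
  --> dderive f x v.
Proof.
move=> oU [_ [df [dfc _]]] Ux W /convex_open_nbhs[C [oC Cd CW Cconv]].
have Q : nbhs (x, v) [set z : E * E | U z.1 /\ C (dderive f z.1 z.2)].
  apply: filterI.
    exists (U, setT); last by move=> z [].
    by split; [exact: open_nbhs_nbhs|exact: filterT].
  by apply: (dfc (x, v)); [rewrite inE|exact: open_nbhs_nbhs].
(* Continuity of [g] at [((x, v), 0)] keeps the whole segment from [y] to [y + tu], with direction
   [u], inside the set of [Q]. *)
pose g (p : (E * E) * R^o) : E * E := (p.1.1 + p.2 *: p.1.2, p.1.2).
have gc : g @ nbhs ((x, v), (0 : R^o)) --> (x, v).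
  rewrite -[X in _ --> (X, _)](addr0 x) -(scale0r v).
  apply: (@cvg_pair _ _ _ _ (nbhs _) (nbhs _)).
    apply: tvs_cvgD.
      apply: (@cvg_comp _ _ _ (fun p : (E * E) * R^o => p.1) fst _ (nbhs (x, v))).
        exact: cvg_fst.
      exact: cvg_fst.
    apply: tvs_cvgZ; first exact: cvg_snd.
    apply: (@cvg_comp _ _ _ (fun p : (E * E) * R^o => p.1) snd _ (nbhs (x, v))).
      exact: cvg_fst.
    exact: cvg_snd.
  apply: (@cvg_comp _ _ _ (fun p : (E * E) * R^o => p.1) snd _ (nbhs (x, v))).
    exact: cvg_fst.
  exact: cvg_snd.
have [[P T] /= [nP nT] PT] := gc _ Q.
have [d /= d0 dT] := (nbhs_ballP (0 : R^o) T).1 nT.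
exists (P, [set t : R | t != 0 /\ `|t| < d]).
  split=> //=; near=> t; split.
    by near: t; exact: nbhs_dnbhs_neq.
  by near: t; exact: dnbhs0_lt.
move=> [[y u] t] /= [Pyu [t0 td]]; apply: CW.
(* Scaled so that the increment over [[0, 1]] is the wanted quotient and the derivative at [s] is
   that of [f] at [y + stu] along [u]. *)
pose phi s := t^-1 *: f (y + (s * t) *: u).
have -> : t^-1 *: (f (y + t *: u) - f y) = phi 1 - phi 0.
  by rewrite /phi mul1r mul0r scale0r addr0 scalerBr.
apply: convex_mean_value => // s /andP[s0 s1].
have [Uz Cz] : U (y + (s * t) *: u) /\ C (dderive f (y + (s * t) *: u) u).
  apply: (PT ((y, u), s * t)); split => //=.
  apply: dT; rewrite -ball_normE/= sub0r normrN normrM ger0_norm//.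
  by apply: le_lt_trans td; rewrite ler_piMl.
have := has_dderive (df _ u Uz) => /(has_deriveZ t)/(tvs_cvgZr t^-1).
move=> /(_ C); rewrite scalerA mulVf// scale1r.
move=> /(_ (open_nbhs_nbhs (conj oC Cz))).
rewrite !nbhs_simpl/=; apply: filterS => h.
by rewrite /phi /preimage /= mulrDl scalerDl addrA -scalerBr !scalerA (mulrC h^-1).
Unshelve. all: by end_near. Qed.

Arguments class_C1_strict {E F U f x} v.

Lemma class_C1_has_dderive E F (U : set E) (f : E -> F) (x v : E) :
  class_C 1 U f -> U x -> has_derive f x v (dderive f x v).
Proof. by move=> [_ [df _]] Ux; apply/has_dderive/df. Qed.

Arguments class_C1_has_dderive {E F U f x} v.

(** Write [c h = x + h *: u_h], where [u_h] is the difference quotient of [c] and tends to [w];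
    strict differentiability allows the direction to vary with [h]. *)
Lemma class_C1_chain E F (U : set E) (f : E -> F) (c : R -> E) (x w : E) :
  open U -> class_C 1 U f -> U x -> curve_derive c x w ->
  curve_derive (f \o c) (f x) (dderive f x w).
Proof.
move=> oU fC Ux cw.
have := class_C1_strict w oU fC Ux.
have cc : (fun h : R => ((x, h^-1 *: (c h - x)), h)) @ (0 : R)^' -->
    filter_prod (filter_prod (nbhs x) (nbhs w)) (0 : R)^'.
  by apply: (cvg_pair (cvg_pair _ cw) cvg_id); exact: cvg_cst.
move=> /(cvg_comp _ _ cc); apply: cvg_trans; apply: near_eq_cvg; near=> h.
have h0 : h != 0 by near: h; exact: nbhs_dnbhs_neq.
by rewrite /= scalerA divff// scale1r (addrC x) subrK.
Unshelve. all: by end_near. Qed.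

(** The increment is split at [x + h *: v]; strict differentiability handles the second piece, whose
    base point moves. *)
Lemma class_C1_dderiveD E F (U : set E) (f : E -> F) (x v w : E) :
  hausdorff_space F -> open U -> class_C 1 U f -> U x ->
  dderive f x (v + w) = dderive f x v + dderive f x w.
Proof.
move=> hF oU fC Ux; apply: dderiveE => //.
have fv := class_C1_has_dderive v fC Ux.
have := class_C1_strict w oU fC Ux.
have cc : (fun h : R => ((x + h *: v, w), h)) @ (0 : R)^' -->
    filter_prod (filter_prod (nbhs x) (nbhs w)) (0 : R)^'.
  apply: (cvg_pair (cvg_pair _ _) cvg_id); last exact: cvg_cst.
  exact: curve_derive_cvg (curve_derive_line x v).
move=> /(cvg_comp _ _ cc)/(tvs_cvgD fv); apply: cvg_trans; apply: near_eq_cvg.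
near=> h => /=.
by rewrite (scalerDr h) addrA -scalerDr (addrC (f _ - f x)) addrA subrK.
Unshelve. all: by end_near. Qed.

Lemma class_C1_dderiveZ E F (U : set E) (f : E -> F) (x v : E) (a : R) :
  hausdorff_space F -> class_C 1 U f -> U x ->
  dderive f x (a *: v) = a *: dderive f x v.
Proof.
move=> hF fC Ux; apply: dderiveZ => //.
by exists (dderive f x v); exact: class_C1_has_dderive fC Ux.
Qed.

(* Both sides are limits of the second difference quotients                    *)
(* (f(x+su+tv) - f(x+su) - f(x+tv) + f(x)) / st, by the mean value inequality  *)
(* applied to one variable and strict differentiability in the other.          *)
Lemma dderive_symmetric E F (U : set E) (f : E -> F) (x u v : E) :
  hausdorff_space F -> open U -> class_C 2 U f -> U x ->
  dderive (fun xv : E * E => dderive f xv.1 xv.2) (x, v) (u, 0) =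
  dderive (fun xv : E * E => dderive f xv.1 xv.2) (x, u) (v, 0).
Proof.
move=> hF oU fC2 Ux.
pose df := fun xv : E * E => dderive f xv.1 xv.2.
have oUT : open (U `*` [set: E]) by apply: open_setX => //; exact: openT.
have dfC1 : class_C 1 (U `*` [set: E]) df by case: fC2 => _ [].
have fd : forall x v, U x -> exists w, has_derive f x v w by case: fC2 => _ [].
pose D s t u v := (s * t)^-1 *:
  ((f (x + s *: u + t *: v) - f (x + t *: v)) - (f (x + s *: u) - f x)).
have claim (a b : E) (W : set F) : nbhs (dderive df (x, b) (a, 0)) W ->
    exists2 d : R, 0 < d & forall s t : R, 0 < `|s| < d -> 0 < `|t| < d -> W (D s t a b).
  move=> /convex_open_nbhs[C [oC Cd CW Cconv]].
  have := class_C1_strict (a, 0) oUT dfC1 (conj Ux I : _ (x, b)).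
  move=> /(_ C (open_nbhs_nbhs (conj oC Cd))).
  move=> [[P T] /= [[[P1 P2] /= [nP1 nP2] P12] nT] PT].
  have g1c : (fun t : R^o => (x + t *: b, b)) @ (0 : R^o) --> (x, b).
    apply: cvg_pair; last exact: cvg_cst.
    rewrite /= -{2}(addr0 x) -(scale0r b).
    by apply: tvs_cvgD; [exact: cvg_cst|apply: tvs_cvgZ; [exact: cvg_id|exact: cvg_cst]].
  have g2c : (fun p : R^o * R^o => x + p.1 *: a + p.2 *: b) @
      nbhs (0 : R^o, 0 : R^o) --> x.
    rewrite -[X in _ --> X](addr0 x) -(scale0r b).
    apply: tvs_cvgD.
      rewrite -[X in _ --> X](addr0 x) -(scale0r a).
      apply: tvs_cvgD; first exact: cvg_cst.
      by apply: tvs_cvgZ; [exact: cvg_fst|exact: cvg_cst].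
    by apply: tvs_cvgZ; [exact: cvg_snd|exact: cvg_cst].
  have [d1 /= d10 dP1] := (nbhs_ballP (0 : R^o) _).1 (g1c _ nP1).
  have [[T1 T2] /= [nT1 nT2] T12] := g2c _ (open_nbhs_nbhs (conj oU Ux)).
  have [d2 /= d20 dT1] := (nbhs_ballP (0 : R^o) _).1 nT1.
  have [d3 /= d30 dT2] := (nbhs_ballP (0 : R^o) _).1 nT2.
  have [d4 /= d40 dT] := (nbhs_ballP (0 : R^o) _).1 nT.
  exists (Num.min (Num.min d1 d2) (Num.min d3 d4)).
    by rewrite !lt_min d10 d20 d30.
  move=> s t; rewrite !lt_min => /andP[s0 /andP[/andP[sd1 sd2] /andP[sd3 sd4]]].
  move=> /andP[t0 /andP[/andP[td1 td2] /andP[td3 td4]]]; apply: CW.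
  rewrite !normr_gt0 in s0 t0.
  have inU (p q : R) : `|p| < d2 -> `|q| < d3 -> U (x + p *: a + q *: b).
    move=> pd qd; apply: (T12 (p, q)); split => /=.
      by apply: dT1; rewrite -ball_normE/= sub0r normrN.
    by apply: dT2; rewrite -ball_normE/= sub0r normrN.
  (* The mean value inequality is used along [b]: the derivative of [phi] is the quotient of
     [df (_, b)] for the increment [s *: a], which strict differentiability of [df] places in
     [C]. *)
  pose phi r := (s * t)^-1 *: (f (x + s *: a + (r * t) *: b) - f (x + (r * t) *: b)).
  have -> : D s t a b = phi 1 - phi 0.
    by rewrite /phi mul1r mul0r scale0r !addr0 -scalerBr.
  apply: convex_mean_value => // r /andP[r0 r1].
  have rt d : `|t| < d -> `|r * t| < d.
    by apply: le_lt_trans; rewrite normrM ger0_norm// ler_piMl.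
  have Uz1 := inU _ _ sd2 (rt _ td3).
  have Uz0 : U (x + (r * t) *: b).
    by have := inU 0 _; rewrite scale0r addr0; apply; [rewrite normr0|exact: rt].
  have : C (s^-1 *: (df (x + s *: a + (r * t) *: b, b) - df (x + (r * t) *: b, b))).
    have -> : (x + s *: a + (r * t) *: b, b) =
        (x + (r * t) *: b, b) + s *: (a, 0) :> E * E.
      by congr pair; [rewrite addrAC|rewrite /= scaler0 addr0].
    apply: (PT (((x + (r * t) *: b, b), (a, 0)), s)); split.
      apply: P12; split => /=; last exact: nbhs_singleton.
      by apply: dP1; rewrite -ball_normE/= sub0r normrN; exact: rt.
    by apply: dT => //; rewrite -ball_normE/= sub0r normrN.
  move=> Cz.
  have := tvs_cvgZr (s * t)^-1 (tvs_cvgB (has_deriveZ t (has_dderive (fd _ b Uz1)))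
    (has_deriveZ t (has_dderive (fd _ b Uz0)))).
  rewrite -scalerBr scalerA invfM -mulrA mulVf// mulr1.
  move=> /(_ _ _ C (open_nbhs_nbhs (conj oC Cz))).
  rewrite !nbhs_simpl/=; apply: filterS => h.
  rewrite /phi /preimage /= mulrDl !scalerDl !addrA -scalerBr -scalerBr !scalerA invfM.
  rewrite (mulrC _ h^-1) !opprB.
  move=> Ch; congr (C _): Ch; congr (_ *: _).
  by rewrite addrACA [in RHS]addrACA [- _ + _]addrC.
(* Distinct limits would have disjoint neighbourhoods, both containing the second difference
   quotient, which is symmetric when [s = t]. *)
apply: contrapT => /eqP ne.
move: hF; rewrite open_hausdorff => /(_ _ _ ne).
move=> [[W1 W2] /= [/[!inE] W1d W2d] [oW1 oW2 W12]].
have [d1 d10 H1] := claim u v W1 (open_nbhs_nbhs (conj oW1 W1d)).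
have [d2 d20 H2] := claim v u W2 (open_nbhs_nbhs (conj oW2 W2d)).
pose s := Num.min d1 d2 / 2.
have m0 : 0 < Num.min d1 d2 by rewrite lt_min d10.
have s0 : 0 < s by rewrite divr_gt0.
have sm : s < Num.min d1 d2 by rewrite /s ltr_pdivrMr// ltr_pMr// ltr1n.
move: sm; rewrite lt_min => /andP[sd1 sd2].
have h1 : W1 (D s s u v) by apply: H1; rewrite gtr0_norm// s0.
have h2 : W2 (D s s v u) by apply: H2; rewrite gtr0_norm// s0.
suff: set0 (D s s u v) by [].
rewrite -W12; split=> //; rewrite (_ : D s s u v = D s s v u)//.
rewrite /D (addrAC x); congr (_ *: _).
rewrite !opprB -!addrA; congr (_ + _).
by rewrite addrCA [RHS]addrCA (addrC (- _)).
Unshelve. all: by end_near. Qed.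

End curve_derive.
Arguments curve_derive_cst {R E} x.
Arguments curve_derive_line {R E} x v.
Arguments has_deriveZ {R E F f x v w} a.
Arguments class_C1_strict {R E F U f x} v.
Arguments class_C1_has_dderive {R E F U f x} v.

(** * Linear maps and their effect on velocities *)

Section linear_maps.
Context {R : realType}.

Section algebraic.
Context {U V : lmodType R} {f : U -> V} (lf : linear f).

Lemma linear_fun0 : f 0 = 0.
Proof. by have := lf (-1) 0 0; rewrite scaler0 addr0 scaleN1r addNr. Qed.

Lemma linear_funZ a u : f (a *: u) = a *: f u.
Proof. by have := lf a u 0; rewrite !addr0 linear_fun0 addr0. Qed.

Lemma linear_funD u v : f (u + v) = f u + f v.
Proof. by have := lf 1 u v; rewrite !scale1r. Qed.

Lemma linear_funN u : f (- u) = - f u.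
Proof. by rewrite -scaleN1r linear_funZ scaleN1r. Qed.

Lemma linear_funB u v : f (u - v) = f u - f v.
Proof. by rewrite linear_funD linear_funN. Qed.

End algebraic.

Lemma curve_derive_linear (E F : tvsType R) (f : E -> F) (c : R -> E) (x w : E) :
  linear f -> continuous f -> curve_derive c x w ->
  curve_derive (f \o c) (f x) (f w).
Proof.
move=> lf cf cw; have := cvg_comp _ _ cw (cf w); apply: cvg_trans.
by apply: near_eq_cvg; near=> h => /=; rewrite (linear_funZ lf) (linear_funB lf).
Unshelve. all: by end_near. Qed.

End linear_maps.

(** * Charts and Lie groups *)

Section charts.
Context {R : realType}.

(** Near each of its points, the set contains a neighbourhood cut out by the preimage of [V] under
    [f \o chart_inv c], which is continuous on the chart image. *)
Lemma chart_image_open (M N : topologicalType) (E : tvsType R) (c : chart M E)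
    (f : M -> N) (V : set N) : is_chart c -> continuous f -> open V ->
  open (chart_map c @` (chart_dom c `&` f @^-1` V)).
Proof.
move=> [oD oU cK _ kc] fc oV; rewrite openE => _ [a [Da Va] <-].
have Ua : (chart_map c @` chart_dom c) (chart_map c a) by exists a.
have nU : nbhs (chart_map c a) (chart_map c @` chart_dom c) by exact: open_nbhs_nbhs.
have nV : nbhs (chart_map c a) (chart_inv c @^-1` (f @^-1` V)).
  apply: kc; first by rewrite inE.
  by apply: fc; rewrite cK//; exact: open_nbhs_nbhs.
apply: filterS (filterI nU nV) => _ [[b Db <-] /= Vb].
by exists b => //; split => //; rewrite /= -(cK b).
Qed.

Lemma is_chart_prod (M N : topologicalType) (E F : tvsType R) (chM : atlas M E)
    (chN : atlas N F) (p : M * N) : is_chart (chM p.1) -> is_chart (chN p.2) ->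
  is_chart (prod_atlas chM chN p).
Proof.
move=> [oD oU cK cc kc] [oD' oU' cK' cc' kc'].
have imX : chart_map (prod_atlas chM chN p) @` chart_dom (prod_atlas chM chN p) =
    (chart_map (chM p.1) @` chart_dom (chM p.1)) `*`
    (chart_map (chN p.2) @` chart_dom (chN p.2)).
  apply/seteqP; split=> [_ [[a b] [/= Da Db] <-]|[_ _] [/= [a Da <-] [b Db <-]]].
    by split; [exists a|exists b].
  by exists (a, b).
split.
- rewrite openE => -[a b] [/= Da Db].
  exists (chart_dom (chM p.1), chart_dom (chN p.2)) => //.
  by split; exact: open_nbhs_nbhs.
- by rewrite imX; exact: open_setX.
- by move=> [a b] [/= Da Db]; rewrite cK ?cK'.
- move=> [a b] /[!inE] -[/= Da Db]; apply: cvg_pair.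
    by apply: (cvg_comp fst _ cvg_fst); apply: cc; rewrite inE.
  by apply: (cvg_comp snd _ cvg_snd); apply: cc'; rewrite inE.
- move=> [a b]; rewrite imX inE => -[/= Da Db]; apply: cvg_pair.
    by apply: (cvg_comp fst _ cvg_fst); apply: kc; rewrite inE.
  by apply: (cvg_comp snd _ cvg_snd); apply: kc'; rewrite inE.
Qed.

End charts.

(** * The Lie group in the chart at the identity: adjoint action and bracket *)

Section lie_group_calculus.
Context {R : realType} {E : tvsType R} {G : preTopologicalGroupType}.
Context {ch : atlas G E} (HG : is_lie_group ch).

Local Notation D := (chart_dom (ch 1%g)).
Local Notation phi := (chart_map (ch 1%g)).
Local Notation psi := (chart_inv (ch 1%g)).
Local Notation e := (phi 1%g).
Local Notation U := (phi @` D).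

(** The product and the inverse read in the chart at the identity. Their domains [W] and [Wi] are
    the sets on which [is_lie_group] provides smoothness ([mulE], [invE]). *)
Let mul (z : E * E) : E := phi (psi z.1 * psi z.2)%g.
Let inv (x : E) : E := phi (psi x)^-1%g.
Let W := [set z : E * E | [/\ U z.1, U z.2 & D (psi z.1 * psi z.2)%g]].
Let Wi := [set x : E | U x /\ D (psi x)^-1%g].
Let dmul (z : (E * E) * (E * E)) : E := dderive mul z.1 z.2.

Let hausE : hausdorff_space E.
Proof. by case: HG => -[]. Qed.

Let D1 : D 1%g.
Proof. by case: HG => _ [_ /(_ 1%g)]. Qed.

Let ch1 : is_chart (ch 1%g).
Proof. by case: HG => _ [_ _ /(_ 1%g)]. Qed.

Let psiK a : D a -> psi (phi a) = a.
Proof. by case: ch1 => _ _ + _ _; apply. Qed.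

Let oU : open U.
Proof. by case: ch1. Qed.

Let Ue : U e.
Proof. by exists 1%g. Qed.

Let psie : psi e = 1%g.
Proof. exact: psiK. Qed.

Let phiK x : U x -> phi (psi x) = x.
Proof. by move=> [a Da <-]; rewrite psiK. Qed.

Let Dpsi x : U x -> D (psi x).
Proof. by move=> [a Da <-]; rewrite psiK. Qed.

Let mulE : W =
  chart_map (prod_atlas ch ch (1%g, 1%g)) @`
     (chart_dom (prod_atlas ch ch (1%g, 1%g)) `&`
      (fun ab : G * G => (ab.1 * ab.2)%g) @^-1` D).
Proof.
apply/seteqP; split=> [[x y] [/= Ux Uy Dxy]|_ [[a b] [[/= Da Db] Dab] <-]].
  by exists (psi x, psi y) => /=; [split => //; split; exact: Dpsi|rewrite !phiK].
by split => /=; [exists a|exists b|rewrite !psiK].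
Qed.

Let oW : open W.
Proof.
rewrite mulE; apply: chart_image_open.
- exact: (@is_chart_prod R G G E E ch ch (1%g, 1%g)).
- by case: HG => _ _ [].
- by case: ch1.
Qed.

Let mul_smooth n : class_C n W mul.
Proof. by rewrite mulE; case: HG => _ _ [_ /(_ (1%g, 1%g) 1%g)]. Qed.

Let invE : Wi = phi @` (D `&` (fun a : G => (a^-1)%g) @^-1` D).
Proof.
apply/seteqP; split=> [x [Ux Dx]|_ [a [Da Dai] <-]].
  by exists (psi x); [split => //; exact: Dpsi|rewrite phiK].
by split; [exists a|rewrite psiK].
Qed.

Let oWi : open Wi.
Proof.
rewrite invE; apply: chart_image_open => //.
- by case: HG => _ _ _ [].
- by case: ch1.
Qed.

Let inv_smooth n : class_C n Wi inv.
Proof. by rewrite invE; case: HG => _ _ _ [_ /(_ 1%g 1%g)]. Qed.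

Let W1 x : U x -> W (x, e).
Proof. by move=> Ux; split => //=; rewrite psie mulg1; exact: Dpsi. Qed.

Let Wie : Wi e.
Proof. by split => //; rewrite psie invg1. Qed.

Let inve : inv e = e.
Proof. by rewrite /inv psie invg1. Qed.

Let Uinv x : Wi x -> U (inv x).
Proof. by move=> [_ Dx]; exists (psi x)^-1%g. Qed.

Let psi_inv x : Wi x -> psi (inv x) = (psi x)^-1%g.
Proof. by move=> [_ Dx]; rewrite psiK. Qed.

Let psi_mul z : W z -> psi (mul z) = (psi z.1 * psi z.2)%g.
Proof. by move=> [_ _ Dz]; rewrite psiK. Qed.

Let Winv x : Wi x -> W (x, inv x).
Proof.
move=> Wx; split => /=; [by case: Wx|exact: Uinv|].
by rewrite psi_inv// mulgV.
Qed.

Let mulx1 x : U x -> mul (x, e) = x.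
Proof. by move=> Ux; rewrite /mul/= psie mulg1 phiK. Qed.

Let mul1x x : U x -> mul (e, x) = x.
Proof. by move=> Ux; rewrite /mul/= psie mul1g phiK. Qed.

Let near_curve (F : tvsType R) (V : set F) (c : R -> F) (x w : F) :
  open V -> V x -> curve_derive c x w -> \forall h \near (0 : R)^', V (c h).
Proof.
by move=> oV Vx /curve_derive_cvg; apply; exact: open_nbhs_nbhs.
Qed.

Let dmul_class : class_C 1 (W `*` [set: E * E]) dmul.
Proof. by have [_ []] := mul_smooth 2. Qed.

Let oWT : open (W `*` [set: E * E]).
Proof. by apply: open_setX => //; exact: openT. Qed.

Let dmulD z v w : W z -> dmul (z, v + w) = dmul (z, v) + dmul (z, w).
Proof. by move=> Wz; exact: (class_C1_dderiveD _ _ hausE oW (mul_smooth 1)). Qed.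

Let dmul_l x v : U x -> dmul ((x, e), (v, 0)) = v.
Proof.
move=> Ux; apply: dderiveE => //.
apply: (@curve_derive_near _ _ (fun h => x + h *: v)).
  near=> h; have Uh : U (x + h *: v).
    by near: h; exact: near_curve (curve_derive_line x v).
  by rewrite -[LHS]mulx1//; congr mul; congr pair; rewrite /= scaler0 addr0.
by rewrite /= mulx1//; exact: curve_derive_line.
Unshelve. all: by end_near. Qed.

Let dmul_r v : dmul ((e, e), (0, v)) = v.
Proof.
apply: dderiveE => //.
apply: (@curve_derive_near _ _ (fun h => e + h *: v)).
  near=> h; have Uh : U (e + h *: v).
    by near: h; exact: near_curve (curve_derive_line e v).
  by rewrite -[LHS]mul1x//; congr mul; congr pair; rewrite /= scaler0 addr0.
by rewrite /= mulx1//; exact: curve_derive_line.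
Unshelve. all: by end_near. Qed.

(** Differentiating [mul (x, inv x) = e] at [e] gives [v + dderive inv e v = 0]. *)
Let dinv v : dderive inv e v = - v.
Proof.
have ci := class_C1_chain oWi (inv_smooth 1) Wie (curve_derive_line e v).
have := class_C1_chain oW (mul_smooth 1) (Winv Wie)
  (curve_derive_pair (curve_derive_line e v) ci).
rewrite inve mulx1// => c1.
have c0 : curve_derive (fun=> e) e (dderive mul (e, e) (v, dderive inv e v)).
  apply: curve_derive_near c1; near=> h.
  have Wh : Wi (e + h *: v).
    by near: h; exact: near_curve (curve_derive_line e v).
  by rewrite /mul/= psi_inv// mulgV.
have := curve_derive_unique hausE c0 (curve_derive_cst e).
have -> : (v, dderive inv e v) = (v, 0) + (0, dderive inv e v).
  by congr pair; rewrite ?addr0 ?add0r.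
rewrite -[dderive _ _ _]/(dmul ((e, e), (v, 0) + (0, dderive inv e v))).
rewrite dmulD ?dmul_l ?dmul_r//; last exact: W1.
by move/eqP; rewrite addrC addr_eq0 => /eqP.
Unshelve. all: by end_near. Qed.

(** Conjugation is a right translation after a left one. Writing it through [dmul], which is C^1,
    makes [Ad] differentiable in the group variable. *)
Let Ad_mul x xi : Wi x ->
  @Ad R E G ch (psi x) xi = dmul ((x, inv x), (dmul ((x, e), (0, xi)), 0)).
Proof.
move=> Wx; have [Ux _] := Wx; rewrite /Ad /tmap/= mulg1 mulgV.
apply: dderiveE => //.
have c1 : curve_derive (fun h => mul (x, e + h *: xi)) x (dmul ((x, e), (0, xi))).
  rewrite -{2}(mulx1 Ux).
  exact: (class_C1_chain oW (mul_smooth 1) (W1 Ux)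
    (curve_derive_pair (curve_derive_cst x) (curve_derive_line e xi))).
have := class_C1_chain oW (mul_smooth 1) (Winv Wx)
  (curve_derive_pair c1 (curve_derive_cst (inv x))).
have -> : mul (x, inv x) = phi (psi x * psi e / psi x)%g.
  by rewrite /mul/= psi_inv// psie mulg1.
apply: curve_derive_near; near=> h.
have Wh : W (x, e + h *: xi).
  near: h; apply: (near_curve oW (W1 Ux)).
  exact: (curve_derive_pair (curve_derive_cst x) (curve_derive_line e xi)).
by rewrite /mul/= [in LHS]psi_inv// -[psi (phi _)]/(psi (mul (x, e + h *: xi))) psi_mul.
Unshelve. all: by end_near. Qed.

(** Mixed second derivative of the product at the identity, with [w] in the left factor and [xi] in
    the right one. *)
Let B (w xi : E) : E := dderive dmul ((e, e), (0, xi)) ((w, 0), 0).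

Let B_sym w xi : B w xi = dderive dmul ((e, e), (w, 0)) ((0, xi), 0).
Proof.
exact: (dderive_symmetric _ _ hausE oW (mul_smooth 2) (W1 Ue)).
Qed.

Let ddmulN z v : W z.1 -> dderive dmul z (- v) = - dderive dmul z v.
Proof.
move=> Wz; rewrite -scaleN1r -(scaleN1r (dderive dmul z v)).
exact: (@class_C1_dderiveZ _ _ _ _ dmul z v (-1) hausE dmul_class (conj Wz I)).
Qed.

Let BNl w xi : B (- w) xi = - B w xi.
Proof.
rewrite /B -ddmulN; last exact: W1.
by congr (dderive _ _ _); congr pair; [congr pair|]; rewrite /= oppr0.
Qed.

Let BNr w xi : B w (- xi) = - B w xi.
Proof.
rewrite !B_sym -ddmulN; last exact: W1.
by congr (dderive _ _ _); congr pair; [congr pair|]; rewrite /= oppr0.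
Qed.

(** Three things move in [Ad_mul]: the left factor contributes 0, the inverse on the right
    contributes [- B xi w], and the left-translated vector contributes [B w xi]. *)
Let curve_derive_Ad (c : R -> E) (w xi : E) : curve_derive c e w ->
  curve_derive (fun h => @Ad R E G ch (psi (c h)) xi) xi (B w xi - B xi w).
Proof.
move=> cw.
have ci := class_C1_chain oWi (inv_smooth 1) Wie cw.
rewrite inve dinv in ci.
have cb := class_C1_chain oWT dmul_class (conj (W1 Ue) I : (_ `*` _) ((e, e), (0, xi)))
  (curve_derive_pair (curve_derive_pair cw (curve_derive_cst e))
    (curve_derive_cst (0, xi))).
rewrite dmul_r in cb.
have := class_C1_chain oWT dmul_class (conj (W1 Ue) I : (_ `*` _) ((e, e), (xi, 0)))
  (curve_derive_pair (curve_derive_pair cw ci)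
    (curve_derive_pair cb (curve_derive_cst 0))).
rewrite dmul_l//.
have -> : ((w, - w), (dderive dmul ((e, e), (0, xi)) ((w, 0), 0), 0)) =
   ((w, 0), 0) + ((0, - w), 0) + (0, (B w xi, 0)) :> (E * E) * (E * E).
  by congr pair; congr pair; rewrite /= ?addr0 ?add0r.
rewrite !(class_C1_dderiveD _ _ hausE oWT dmul_class); try by split => //; exact: W1.
(* Since [mul (x, e) = x], the value [dmul ((x, e), (xi, 0))] is [xi] for all [x] near [e]. *)
have -> : dderive dmul (e, e, (xi, 0)) (w, 0, 0) = 0.
  apply: dderiveE => //; apply: curve_derive_near (curve_derive_cst _).
  near=> h; have Uh : U (e + h *: w).
    by near: h; exact: near_curve (curve_derive_line e w).
  rewrite dmul_l// -[in LHS](dmul_l xi Uh); congr dmul.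
  by congr pair; congr pair; rewrite /= scaler0 addr0.
have -> : dderive dmul (e, e, (xi, 0)) (0, - w, 0) = - B xi w by rewrite -B_sym BNr.
have -> : dderive dmul (e, e, (xi, 0)) (0, (B w xi, 0)) = B w xi.
  apply: dderiveE => //.
  apply: (@curve_derive_near _ _ (fun h => xi + h *: B w xi)).
    apply: nearW => h; rewrite -[LHS](dmul_l _ Ue); congr dmul.
    by congr pair; congr pair; rewrite /= ?scaler0 ?addr0.
  by rewrite dmul_l//; exact: curve_derive_line.
rewrite add0r addrC; apply: curve_derive_near.
near=> h; rewrite /= Ad_mul//.
by near: h; exact: near_curve cw.
Unshelve. all: by end_near. Qed.

Let Ad1 xi : @Ad R E G ch 1%g xi = xi.
Proof. by rewrite -psie Ad_mul// inve dmul_r dmul_l. Qed.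

Let adE (v xi : lie_algebra ch) : ad v xi = B v xi - B xi v.
Proof.
apply: dderiveE => //; rewrite /has_derive/= psie Ad1.
exact: (@curve_derive_Ad _ _ xi (curve_derive_line e v)).
Qed.

Lemma adC (v xi : lie_algebra ch) : ad v xi = - ad xi v.
Proof. by rewrite !adE opprB. Qed.

(** The curve [<Ads a m, xi> = <m, Ad (a^-1) xi>] is differentiated in both forms; the inverse curve
    has velocity [- v], whence the sign. *)
Lemma pair_generator (gs : tvsType R) (pair : gs -> lie_algebra ch -> R)
    (Ads : G -> gs -> gs) (v xi : lie_algebra ch) (m : gs) :
  is_regular_dual pair -> is_coadjoint_action pair Ads ->
  pair (generator Ads v m) xi = - pair m (ad v xi).
Proof.
move=> [[pl pr] [cpl cpr] _ _] [AdsE Ads_smooth].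
have [_ /(_ 1%g 0 1%N)[_ [Ads_derive _]]] := Ads_smooth m.
have := Ads_derive e v; rewrite /= => /(_ _)/has_dderive gd.
have {}gd : curve_derive (fun h : R => Ads (psi (e + h *: v)) m) (Ads (psi e) m)
    (generator Ads v m).
  by apply: gd; exists 1%g.
rewrite psie in gd.
have c1 := curve_derive_linear (pl xi) (cpl xi) gd.
have ci := class_C1_chain oWi (inv_smooth 1) Wie (curve_derive_line e v).
rewrite inve dinv in ci.
have c2 := curve_derive_linear (pr m) (cpr m) (@curve_derive_Ad _ _ xi ci).
have hausR : hausdorff_space R^o by exact: Rhausdorff.
apply: (curve_derive_unique hausR c1).
rewrite /= AdsE invg1 Ad1 -(linear_funN (pr m)) adE opprB.
rewrite BNl BNr opprK addrC in c2.
apply: curve_derive_near c2; near=> h; rewrite /= AdsE -psi_inv//.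
by near: h; exact: near_curve (curve_derive_line e v).
Unshelve. all: by end_near. Qed.

End lie_group_calculus.

(** * Tangent maps of smooth maps *)

Section tangent_maps.
Context {R : realType} (M N : topologicalType) (E F : tvsType R).
Context (chM : atlas M E) (chN : atlas N F) (f : M -> N).
Hypothesis chart_M : forall p, is_chart (chM p).
Hypothesis inM : forall p, chart_dom (chM p) p.
Hypothesis open_N : forall q, open (chart_dom (chN q)).
Hypothesis inN : forall q, chart_dom (chN q) q.
Hypothesis f_smooth : smooth chM chN f.

Lemma smooth_chart_C1 (p : M) : exists V : set E,
  [/\ open V, V (chart_map (chM p) p) &
      class_C 1 V (chart_map (chN (f p)) \o f \o chart_inv (chM p))].
Proof.
case: f_smooth => fc fC; eexists; split; last exact: fC.
- exact: chart_image_open.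
- by exists p => //; split; [exact: inM|exact: inN].
Qed.

Lemma tmap_linear (p : M) : hausdorff_space F -> linear (tmap chM chN f p).
Proof.
move=> hF a u v; have [V [oV Vp fV]] := smooth_chart_C1 p.
by rewrite /tmap (class_C1_dderiveD _ _ hF oV fV Vp) (class_C1_dderiveZ _ _ hF fV Vp).
Qed.

Lemma tmap_curve (p : M) (c : R -> E) (v : E) :
  curve_derive c (chart_map (chM p) p) v ->
  curve_derive (chart_map (chN (f p)) \o f \o chart_inv (chM p) \o c)
    (chart_map (chN (f p)) (f p)) (tmap chM chN f p v).
Proof.
move=> cv; have [V [oV Vp fV]] := smooth_chart_C1 p.
have := class_C1_chain oV fV Vp cv.
by have [_ _ pK _ _] := chart_M p; rewrite /= pK.
Qed.

End tangent_maps.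

(** * The gradient on a coadjoint orbit *)

Section orthogonal_projection.
Context {R : realType} (V : lmodType R) (B : V -> V -> R) (W : set V).
Hypothesis Bl : forall u, linear (B^~ u : V -> R^o).
Hypothesis Bsym : forall u v, B u v = B v u.
Hypothesis Bpos : forall u, u != 0 -> 0 < B u u.
Hypotheses (W0 : W 0) (WD : forall u v, W u -> W v -> W (u + v)).
Hypothesis WZ : forall (a : R) u, W u -> W (a *: u).

Let orthogonal_family k (t : 'I_k -> V) :=
  [/\ forall i, W (t i), forall i, t i != 0 & forall i j, i != j -> B (t i) (t j) = 0].

Let suml (I : finType) (a : I -> R) (t : I -> V) u :
  B (\sum_i a i *: t i) u = \sum_i a i * B (t i) u.
Proof.
rewrite (big_morph _ (linear_funD (Bl u)) (linear_fun0 (Bl u))).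
by apply: eq_bigr => i _; rewrite (linear_funZ (Bl u)).
Qed.

Let sum_orthogonal k (t : 'I_k -> V) (a : 'I_k -> R) j :
  orthogonal_family t -> B (\sum_i a i *: t i) (t j) = a j * B (t j) (t j).
Proof.
move=> [_ _ to]; rewrite suml (bigD1 j)//= big1 ?addr0// => i ij.
by rewrite to// mulr0.
Qed.

(** With more vectors than generators, the coordinate matrix has a nonzero left kernel, hence there
    is a nontrivial linear relation among the [t i]; pairing it with each [t j] kills every
    coefficient. *)
Let orthogonal_family_size (s : seq V) k (t : 'I_k -> V) :
  (forall v, exists c : nat -> R, v = \sum_(i < size s) c i *: s`_i) ->
  orthogonal_family t -> (k <= size s)%N.
Proof.
move=> hs ot; rewrite leqNgt; apply/negP => sk.
have [c ct] := choice (fun i => hs (t i)).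
pose C := \matrix_(i < k, j < size s) c i j.
have : kermx C != 0.
  rewrite kermx_eq0 /row_free; apply/negP => /eqP rk.
  by have := rank_leq_col C; rewrite rk leqNgt sk.
move=> /rowV0Pn[r /sub_kermxP rC /eqP]; apply; apply/rowP => j; rewrite mxE.
have r0 : \sum_i r 0 i *: t i = 0.
  under eq_bigr => i _ do rewrite ct scaler_sumr.
  rewrite exchange_big big1// => l _.
  transitivity (\sum_i (r 0 i * C i l) *: s`_l).
    by apply: eq_bigr => i _; rewrite mxE scalerA.
  rewrite -scaler_suml; have := congr1 (fun M : 'rV_(size s) => M 0 l) rC.
  by rewrite !mxE => ->; rewrite scale0r.
have := sum_orthogonal (fun i => r 0 i) j ot.
rewrite r0 (linear_fun0 (Bl _)) => /esym/eqP; rewrite mulf_eq0 => /orP[/eqP//|].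
by case: ot => _ /(_ j)/Bpos + _; rewrite lt0r => /andP[/negPf ->].
Qed.

(* Gram-Schmidt: project along an orthogonal family of W of maximal length. *)
Lemma finite_dimensional_projection (v : V) : finite_dimensional V ->
  exists w u, [/\ W w, forall z, W z -> B u z = 0 & v = w + u].
Proof.
move=> [s hs].
pose P k := `[< exists t : 'I_k -> V, orthogonal_family t >].
have P0 : P 0%N by apply/asboolP; exists (fun=> 0); split=> -[].
have Pb k : P k -> (k <= size s)%N.
  by move=> /asboolP[t]; exact: orthogonal_family_size.
case: (ex_maxnP (ex_intro (fun k => P k) 0%N P0) Pb) => k /asboolP[t ot] kmax.
have [tW tn0 to] := ot.
pose proj x := \sum_i (B x (t i) / B (t i) (t i)) *: t i.
have Wproj x : W (proj x).
  by rewrite /proj; elim/big_ind : _ => // i _; exact: WZ.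
have projE x i : B (x - proj x) (t i) = 0.
  rewrite (linear_funB (Bl _)) sum_orthogonal// divfK ?subrr//.
  by rewrite gt_eqF// Bpos.
exists (proj v), (v - proj v); split; [exact: Wproj| |by rewrite addrC subrK].
move=> z Wz.
have [z0|zn0] := eqVneq (z - proj z) 0.
  have zE : z = proj z by apply/eqP; rewrite -subr_eq0 z0.
  rewrite zE Bsym suml big1// => i _.
  by rewrite (Bsym (t i) (v - _)) projE mulr0.
(* Adjoining a nonzero residual [z - proj z] to the family would contradict its maximal length. *)
suff /kmax : P k.+1 by rewrite ltnn.
apply/asboolP.
exists (fun i => if unlift ord_max i is Some j then t j else z - proj z).
have Wz' : W (z - proj z) by apply: WD => //; rewrite -scaleN1r; exact: WZ.
split=> [i|i|i j].
- by case: unliftP.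
- by case: unliftP.
case: unliftP => [i'|] ->; case: unliftP => [j'|] -> //=.
- by move=> ij; apply: to; apply: contraNneq ij => ->.
- by rewrite Bsym projE.
- by rewrite eqxx.
Qed.

End orthogonal_projection.

(** * Regular dual, [ad^*] and the generator *)

Section regular_dual.
Context {R : realType} {E : tvsType R} {G : preTopologicalGroupType}.
Context {ch : atlas G E} {gs : tvsType R} {pair : gs -> lie_algebra ch -> R}.
Hypothesis Hdual : is_regular_dual pair.

Lemma pair_inj (m n : gs) : (forall xi, pair m xi = pair n xi) -> m = n.
Proof.
case: Hdual => -[pl _] _ p0 _ mn; apply/eqP; rewrite -subr_eq0; apply/eqP.
by apply: p0 => xi; rewrite (linear_funB (pl xi)) mn subrr.
Qed.

(** The continuous functionals [pair ^~ xi] separate points, so Hausdorffness is inherited from the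
    reals. It makes derivatives in [gs] unique. *)
Lemma regular_dual_hausdorff : hausdorff_space gs.
Proof.
have [_ [cpl _] _ _] := Hdual => m n mn; apply: pair_inj => xi.
apply: Rhausdorff => A B /(cpl xi) nA /(cpl xi) nB.
by have [q [Aq Bq]] := mn _ _ nA nB; exists (pair q xi).
Qed.

(** By [pair_generator], the bracket [ad] yields minus the generator, and [- ad] the generator
    itself. *)
Lemma ad_star_generator (Ads : G -> gs -> gs)
    (br : lie_algebra ch -> lie_algebra ch -> lie_algebra ch)
    (ads : lie_algebra ch -> gs -> gs) :
  is_lie_group ch -> is_coadjoint_action pair Ads -> is_lie_bracket br ->
  is_ad_star pair br ads ->
  ads = generator Ads \/ ads = (fun v m => - generator Ads v m).
Proof.
move=> HG HAds Hbr Hads; have [[pl pr] _ _ _] := Hdual.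
case: Hbr => brE; [right|left]; apply/funext => v; apply/funext => m;
  apply: pair_inj => xi; rewrite Hads brE.
  by rewrite (linear_funN (pl xi)) (pair_generator HG _ _ _ Hdual HAds) opprK.
by rewrite (linear_funN (pr m)) (pair_generator HG _ _ _ Hdual HAds).
Qed.

(* The sign of the generator cancels between the two brackets. *)
Lemma double_bracket_generator (Ads : G -> gs -> gs)
    (br : lie_algebra ch -> lie_algebra ch -> lie_algebra ch)
    (ads : lie_algebra ch -> gs -> gs) (A : lie_algebra ch -> gs)
    (Ainv : gs -> lie_algebra ch) (dF : gs -> lie_algebra ch) (m : gs) :
  is_lie_group ch -> is_coadjoint_action pair Ads -> is_lie_bracket br ->
  is_ad_star pair br ads -> linear (fun v : lie_algebra ch => generator Ads v m) ->
  is_inertia_operator pair A -> cancel Ainv A ->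
  double_bracket ads Ainv dF m = generator Ads (Ainv (generator Ads (dF m) m)) m.
Proof.
move=> HG HAds Hbr Hads gl [lA _ _ bA] AK.
case: (ad_star_generator HG HAds Hbr Hads) => adsE; first by rewrite /double_bracket adsE.
rewrite /double_bracket adsE.
(* Oddness of [Ainv] is deduced from linearity and injectivity of [A]. *)
have -> : Ainv (- generator Ads (dF m) m) = - Ainv (generator Ads (dF m) m).
  by apply: (bij_inj bA); rewrite (linear_funN lA) !AK.
by rewrite (linear_funN gl) opprK.
Qed.

End regular_dual.

(** Hadamard differentiability lets the direction vary, so the difference quotient of the curve in
    [gs] can be substituted for it. *)
Lemma tmap_differential {R : realType} (E : tvsType R) (G : preTopologicalGroupType)
    (ch : atlas G E) (gs : tvsType R) (pair : gs -> lie_algebra ch -> R)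
    (N : topologicalType) (H : tvsType R) (chN : atlas N H)
    (iota : N -> gs) (F : gs -> R) (p : N) (xi : lie_algebra ch) (Y : tangent chN p) :
  is_manifold chN -> smooth chN (vector_atlas gs) iota ->
  has_differential pair F (iota p) xi ->
  tmap chN (vector_atlas R^o) (F \o iota) p Y =
  pair (tmap chN (vector_atlas gs) iota p Y) xi.
Proof.
move=> [_ inN cN _] si HF.
have ci : curve_derive (fun h => iota (chart_inv (chN p) (chart_map (chN p) p + h *: Y)))
    (iota p) (tmap chN (vector_atlas gs) iota p Y).
  by apply: (tmap_curve cN inN _ _ si) => //;
    [move=> q; exact: openT|exact: curve_derive_line].
apply: dderiveE; first exact: Rhausdorff.
have := HF (tmap chN (vector_atlas gs) iota p Y).
have cc := cvg_pair (cvg_id : (fun h : R => h) @ (0 : R)^' --> (0 : R)^') ci.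
move=> /(cvg_comp _ _ (cc _ _ _)); apply: cvg_trans; apply: near_eq_cvg; near=> h.
have h0 : h != 0 by near: h; exact: nbhs_dnbhs_neq.
have [_ _ pK _ _] := cN p.
by rewrite /= scalerA divff// scale1r (addrC (iota p)) subrK pK.
Unshelve. all: by end_near. Qed.

(** * Velocities of curves on the orbit and in the dual *)

Section velocities.
Context {R : realType} (N : topologicalType) (H gs : tvsType R).
Context (chN : atlas N H) (iota : N -> gs).
Hypotheses (mN : is_manifold chN) (si : smooth chN (vector_atlas gs) iota).

Lemma has_velocity_comp (c : R -> N) (t : R) (v : tangent chN (c t)) :
  has_velocity chN c t v ->
  has_velocity (vector_atlas gs) (iota \o c) t
    (tmap chN (vector_atlas gs) iota (c t) v).
Proof.
have [_ inN cN _] := mN; move=> [cc cv]; split.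
  by apply: continuous_comp => //; case: si => + _; apply.
have ci : curve_derive (fun h : R => iota (chart_inv (chN (c t))
      (chart_map (chN (c t)) (c (t + h *: (1 : R^o))))))
    (iota (c t)) (tmap chN (vector_atlas gs) iota (c t) v).
  by apply: (tmap_curve cN inN _ _ si) => // q; exact: openT.
have [oD _ pK _ _] := cN (c t).
(* [chart_inv] undoes [chart_map] only on the chart domain, where continuity keeps the curve for
   small [h]. *)
apply: curve_derive_near ci; near=> h => /=; rewrite pK//.
near: h.
have ct := curve_derive_cvg (curve_derive_line (t : R^o) (1 : R^o)).
have nD : nbhs (c t) (chart_dom (chN (c t))) by exact: open_nbhs_nbhs.
by apply: (cvg_comp _ _ ct cc); exact: nD.
Unshelve. all: by end_near. Qed.

Lemma has_velocity_unique (c : R -> gs) (t : R) (v w : gs) : hausdorff_space gs ->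
  has_velocity (vector_atlas gs) c t v -> has_velocity (vector_atlas gs) c t w -> v = w.
Proof. by move=> hg [_ cv] [_]; exact: curve_derive_unique hg cv. Qed.

End velocities.

Lemma generator_linear {R : realType} (E : tvsType R) (G : preTopologicalGroupType)
    (ch : atlas G E) (gs : tvsType R) (pair : gs -> lie_algebra ch -> R)
    (Ads : G -> gs -> gs) (m : gs) :
  is_lie_group ch -> is_regular_dual pair -> is_coadjoint_action pair Ads ->
  linear (fun v : lie_algebra ch => generator Ads v m).
Proof.
move=> [_ [_ inG cG _] _ _] Hdual [_ /(_ m) sm].
apply: (tmap_linear cG inG _ _ sm) => //; first by move=> q; exact: openT.
exact: regular_dual_hausdorff Hdual.
Qed.

Unset Implicit Arguments.

Theorem proposition5p9
  (R : realType)
  (E : tvsType R) (G : preTopologicalGroupType) (ch : atlas G E)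
  (HG : is_lie_group ch)
  (gs : tvsType R) (pair : gs -> lie_algebra ch -> R)
  (Hdual : is_regular_dual pair)
  (br : lie_algebra ch -> lie_algebra ch -> lie_algebra ch)
  (Hbr : is_lie_bracket br)
  (Ads : G -> gs -> gs) (HAds : is_coadjoint_action pair Ads)
  (ads : lie_algebra ch -> gs -> gs) (Hads : is_ad_star pair br ads)
  (A : lie_algebra ch -> gs) (HA : is_inertia_operator pair A)
  (Ainv : gs -> lie_algebra ch) (HAinv : cancel Ainv A)
  (rho : forall a : G, tangent ch a -> tangent ch a -> R)
  (Hrho : is_right_invariant_metric pair A rho)
  (F : gs -> R) (dF : gs -> lie_algebra ch)
  (HdF : forall m, has_differential pair F m (dF m))
  (m0 : gs)
  (N : topologicalType) (H : tvsType R) (chN : atlas N H) (iota : N -> gs)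
  (HO : is_orbit_submanifold ch Ads chN iota m0)
  (Hsplit : ~ finite_dimensional (lie_algebra ch) ->
     forall m, coadjoint_orbit Ads m0 m ->
       splits (rho 1%g) (isotropy_algebra ch Ads m))
  (gO : forall p : N, tangent chN p -> tangent chN p -> R)
  (HgO : is_induced_metric Ads iota (rho 1%g) gO) :
  exists grad : forall p : N, tangent chN p,
    [/\ is_gradient gO (F \o iota) grad,
        (forall X : forall p : N, tangent chN p,
           is_gradient gO (F \o iota) X -> X = grad),
        (forall p : N,
           double_bracket ads Ainv dF (iota p) =
           tmap chN (vector_atlas gs) iota p (- grad p))
      & (forall (J : set R) (c : R -> N), open J ->
           (forall t, J t -> exists v, has_velocity chN c t v) ->
           ((forall t, J t -> has_velocity chN c t (- grad (c t))) <->
            (forall t, J t ->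
               has_velocity (vector_atlas gs) (iota \o c) t
                 (double_bracket ads Ainv dF (iota (c t))))))].
Proof.
have hausgs := regular_dual_hausdorff Hdual.
have [[pl pr] _ _ _] := Hdual.
have gl m := generator_linear m HG Hdual HAds.
have [mN [inj_iota range_iota] si inj_T range_T] := HO.
have [_ inN cN _] := mN.
have Tl p : linear (tmap chN (vector_atlas gs) iota p).
  by apply: (tmap_linear cN inN _ _ si) => // q; exact: openT.
have [lA symA posA bA] := HA.
have rhoE u v : rho 1%g u v = pair (A u) v by case: Hrho => + _; apply.
have rhol u : linear (fun v => rho 1%g v u : R^o).
  by move=> a v w; rewrite !rhoE lA (pl u).
have rhosym u v : rho 1%g u v = rho 1%g v u by rewrite !rhoE symA.
have isoP (m : gs) (w : lie_algebra ch) :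
  isotropy_algebra ch Ads m w <-> generator Ads w m = 0 by [].
have split_iso p v : exists w u, [/\ generator Ads w (iota p) = 0,
    orthogonal_to (rho 1%g) (isotropy_algebra ch Ads (iota p)) u & v = w + u].
  have [fd|nfd] := pselect (finite_dimensional (lie_algebra ch)).
    apply: (finite_dimensional_projection rhol rhosym _ _ _ _ v fd).
    - by move=> u u0; rewrite rhoE posA.
    - exact: (linear_fun0 (gl _)).
    - by move=> u w /isoP u0 /isoP w0; apply/isoP; rewrite (linear_funD (gl _)) u0 w0 addr0.
    - by move=> a u /isoP u0; apply/isoP; rewrite (linear_funZ (gl _)) u0 scaler0.
  by apply: Hsplit => //; rewrite -range_iota; exists p.
pose V m := Ainv (generator Ads (dF m) m).
(* [pair_generator] is used on both sides of [adC], exchanging [dF m] and [w]. *)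
have VE m w : rho 1%g (V m) w = - pair (generator Ads w m) (dF m).
  rewrite rhoE HAinv (pair_generator HG _ _ _ Hdual HAds).
  by rewrite (adC HG) (linear_funN (pr m)) opprK (pair_generator HG _ _ _ Hdual HAds) opprK.
have Vorth m : orthogonal_to (rho 1%g) (isotropy_algebra ch Ads m) (V m).
  by move=> w /isoP w0; rewrite VE w0 (linear_fun0 (pl _)) oppr0.
have dbE m : double_bracket ads Ainv dF m = generator Ads (V m) m.
  exact: (double_bracket_generator Hdual dF HG HAds Hbr Hads (gl m) HA HAinv).
have grad_ex p : exists X : tangent chN p,
    tmap chN (vector_atlas gs) iota p X = - generator Ads (V (iota p)) (iota p).
  have : range (fun v : lie_algebra ch => generator Ads v (iota p))
      (- generator Ads (V (iota p)) (iota p)).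
    by exists (- V (iota p)) => //; rewrite (linear_funN (gl _)).
  by rewrite -range_T => -[X _ XE]; exists X.
pose grad p : tangent chN p := sval (cid (grad_ex p)).
have gradE p : tmap chN (vector_atlas gs) iota p (grad p) =
    - generator Ads (V (iota p)) (iota p) by rewrite /grad; case: cid.
have dbT p : double_bracket ads Ainv dF (iota p) =
    tmap chN (vector_atlas gs) iota p (- grad p).
  by rewrite dbE (linear_funN (Tl p)) gradE opprK.
have [gOl gOsym gOE] := HgO.
(* The isotropy component of a generating vector does not change the tangent vector and is
   removed. *)
have repr p (Y : tangent chN p) : exists w : lie_algebra ch,
    orthogonal_to (rho 1%g) (isotropy_algebra ch Ads (iota p)) w /\
    tmap chN (vector_atlas gs) iota p Y = generator Ads w (iota p).
  have : range (tmap chN (vector_atlas gs) iota p) (tmap chN (vector_atlas gs) iota p Y).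
    by exists Y.
  rewrite range_T => -[v _ <-]; have [w [u [w0 uo ->]]] := split_iso p v.
  by exists u; split=> //; rewrite (linear_funD (gl _)) w0 add0r.
have orthD p u w : orthogonal_to (rho 1%g) (isotropy_algebra ch Ads (iota p)) u ->
    orthogonal_to (rho 1%g) (isotropy_algebra ch Ads (iota p)) w ->
    orthogonal_to (rho 1%g) (isotropy_algebra ch Ads (iota p)) (u + w).
  by move=> uo wo z zi; rewrite (linear_funD (rhol z)) uo// wo// addr0.
have orthN p u : orthogonal_to (rho 1%g) (isotropy_algebra ch Ads (iota p)) u ->
    orthogonal_to (rho 1%g) (isotropy_algebra ch Ads (iota p)) (- u).
  by move=> uo z zi; rewrite (linear_funN (rhol z)) uo// oppr0.
(* The induced metric is prescribed on the diagonal only; its values at [X], [Y] and [X + Y]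
   determine it by polarization. *)
have polar p (X Y : tangent chN p) (u w : lie_algebra ch) :
    orthogonal_to (rho 1%g) (isotropy_algebra ch Ads (iota p)) u ->
    orthogonal_to (rho 1%g) (isotropy_algebra ch Ads (iota p)) w ->
    tmap chN (vector_atlas gs) iota p X = generator Ads u (iota p) ->
    tmap chN (vector_atlas gs) iota p Y = generator Ads w (iota p) ->
    gO p X Y = rho 1%g u w.
  move=> uo wo XE YE.
  have := gOE p (X + Y) (u + w) (orthD _ _ _ uo wo).
  rewrite (linear_funD (Tl p)) (linear_funD (gl _)) XE YE => /(_ erefl).
  rewrite (linear_funD (gOl _ _)) 2!(gOsym _ (X + Y)) !(linear_funD (gOl _ _)).
  rewrite (gOE _ _ _ uo XE) (gOE _ _ _ wo YE) (gOsym _ Y X).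
  rewrite (linear_funD (rhol _)) 2!(rhosym _ (u + w)) !(linear_funD (rhol _)).
  by rewrite (rhosym w u); lra.
have is_grad : is_gradient gO (F \o iota) grad.
  move=> p Y; have [w [wo YE]] := repr p Y.
  rewrite (polar _ _ _ (- V (iota p)) w)//; last first.
  - by rewrite gradE (linear_funN (gl _)).
  - exact: orthN.
  rewrite (linear_funN (rhol _)) VE opprK -YE.
  by rewrite (tmap_differential _ mN si (HdF (iota p))).
exists grad; split => //.
(* The difference of two gradients has zero length, so positivity of [A] makes its orthogonal
   representative vanish. *)
- move=> X Xgrad; apply: functional_extensionality_dep => p.
  have [w [wo ZE]] := repr p (X p - grad p).
  have : gO p (X p - grad p) (X p - grad p) = 0.
    by rewrite (linear_funB (gOl _ _)) !(gOsym _ (X p - grad p)) Xgrad is_grad subrr.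
  rewrite (gOE _ _ _ wo ZE) rhoE => ww0.
  have w0 : w = 0.
    by apply/eqP; apply: contraT => /posA; rewrite ww0 ltxx.
  apply/eqP; rewrite -subr_eq0; apply/eqP; apply: inj_T.
  by rewrite ZE w0 (linear_fun0 (gl _)) (linear_fun0 (Tl p)).
- move=> J c oJ cv; split=> vel t Jt.
    by rewrite dbT; exact: (has_velocity_comp mN si (vel t Jt)).
  (* The velocity of [c] on the orbit exists by assumption; injectivity of the tangent map of [iota]
     then identifies it from its image in [gs]. *)
  have [v vt] := cv t Jt.
  suff <- : v = - grad (c t) by [].
  apply: inj_T; rewrite -dbT.
  exact: (has_velocity_unique hausgs (has_velocity_comp mN si vt) (vel t Jt)).
Qed.
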